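(* Let $\hat V=\hat V_{+}+\hat V_{-}:(0,\infty)\to\mathbb R$, where $\hat V_{+},\hat V_{-}$ are four times differentiable with $\hat V_{+}^{(4)}(r)\ge 0$ and $\hat V_{-}^{(4)}(r)\le 0$ for all $r>0$. Let $m>0$, $\Delta t_n>0$, and let $\bm q_n,\bm q_{n+1}\in\mathbb R^3\setminus\{\bm 0\}$, $\bm p_n,\bm p_{n+1}\in\mathbb R^3$ satisfy the perturbed trapezoidal integrator $$\bm q_{n+1}-\bm q_n=\frac{\Delta t_n}{m}\,\bm p_{n+\frac12},$$ $$\bm p_{n+1}-\bm p_n=-\Delta t_n\left(\frac{\hat V'(\|\bm q_n\|)+\hat V'(\|\bm q_{n+1}\|)}{2}-\frac{(\|\bm q_{n+1}\|-\|\bm q_n\|)^2}{12}\left(\hat V_{+}'''(\|\bm q_n\|)+\hat V_{-}'''(\|\bm q_{n+1}\|)\right)\right)\frac{\bm q_{n+\frac12}}{\|\bm q\|_{n+\frac12}}.$$ Then $\bm J(\bm q_{n+1},\bm p_{n+1})=\bm J(\bm q_n,\bm p_n)$, and there exist $\xi_1,\xi_2\in(0,1)$ such that $$H(\bm q_{n+1},\bm p_{n+1})-H(\bm q_n,\bm p_n)=-\frac{\left(\|\bm q_{n+1}\|-\|\bm q_n\|\right)^4}{24}\left(\hat V_{+}^{(4)}(\|\bm q\|_{n+\xi_1})-\hat V_{-}^{(4)}(\|\bm q\|_{n+\xi_2})\right)\le 0.$$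
   Context: Single particle of mass $m$ in $\mathbb R^3$ in a central force field with potential $\hat V(\|\bm q\|)$; $\|\cdot\|$ is the Euclidean norm. Hamiltonian: $H(\bm q,\bm p)=\frac{1}{2m}\|\bm p\|^2+\hat V(\|\bm q\|)$. Angular momentum: $\bm J(\bm q,\bm p)=\bm q\times\bm p$. For $\alpha\in[0,1]$: $\bm q_{n+\alpha}:=(1-\alpha)\bm q_n+\alpha\bm q_{n+1}$, $\bm p_{n+\alpha}:=(1-\alpha)\bm p_n+\alpha\bm p_{n+1}$, and $\|\bm q\|_{n+\alpha}:=(1-\alpha)\|\bm q_n\|+\alpha\|\bm q_{n+1}\|$ (which in general differs from $\|\bm q_{n+\alpha}\|$). *)

(* Defs.v *)
From HB Require Import structures.
From mathcomp Require Import all_boot all_order all_algebra.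
From mathcomp Require Import all_classical all_reals all_analysis.

Set Implicit Arguments.
Unset Strict Implicit.
Unset Printing Implicit Defensive.

Import Order.TTheory GRing.Theory Num.Theory.
Import numFieldNormedType.Exports.

Local Open Scope ring_scope.

(* The library norm on row vectors is the sup norm, hence this definition. *)
Definition enorm (R : realType) (q : 'rV[R]_3) : R :=
  Num.sqrt (\sum_(i < 3) q 0 i ^+ 2).

(* Indices are taken in 'I_3, hence modulo 3. *)
Definition cross (R : realType) (u v : 'rV[R]_3) : 'rV[R]_3 :=
  \row_(i < 3) (u 0 (i + 1) * v 0 (i + 2) - u 0 (i + 2) * v 0 (i + 1)).

Definition hamiltonian (R : realType) (m : R) (V : R -> R)
    (q p : 'rV[R]_3) : R :=
  (2 * m)^-1 * enorm p ^+ 2 + V (enorm q).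

Definition angular_momentum (R : realType) (q p : 'rV[R]_3) : 'rV[R]_3 :=
  cross q p.

Definition interp (R : realType) (a : R) (x y : 'rV[R]_3) : 'rV[R]_3 :=
  (1 - a) *: x + a *: y.

(* The interpolated norm, in general different from [enorm (interp a x y)]. *)
Definition interp_norm (R : realType) (a : R) (x y : 'rV[R]_3) : R :=
  (1 - a) * enorm x + a * enorm y.

(* [f] is [n] times differentiable on (0, +oo).  The iterated derivatives are
   total functions, so each one below order [n] must be required to be
   derivable; values of [f] outside (0, +oo) are irrelevant. *)
Definition n_derivable_pos (R : realType) (n : nat) (f : R -> R) : Prop :=
  forall (k : nat) (r : R), (k < n)%N -> 0 < r -> derivable (derive1n k f) r 1.

(* Main.v *)
(* Pairing the momentum equation with [q1 - q0], which is parallel to the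
   midpoint momentum, shows that the kinetic energy increment is minus the
   increment of [enorm q] times the discrete force.  The energy error is
   therefore that of the corrected trapezoidal rule
     f b - f a = (b - a) ((f' a + f' b) / 2 - (b - a)^2 / 12 * f''' a)
                 - (b - a)^4 / 24 * f''''(xi),
   used from [a] to [b] for [Vp] and backwards, from [b] to [a], for [Vm].
   Since the fourth derivative need not be continuous, the Peano kernel is
   replaced by three applications of the mean value theorem. *)

Require Import Defs.
From HB Require Import structures.
From mathcomp Require Import all_boot all_order all_algebra.
From mathcomp Require Import all_classical all_reals all_analysis.
From mathcomp Require Import ring lra.
Set Implicit Arguments.
Unset Strict Implicit.

Import Order.TTheory GRing.Theory Num.Theory.
Import numFieldNormedType.Exports.
Local Open Scope ring_scope.

Lemma mvt_from0 (R : realType) (f df : R -> R) (u : R) : 0 < u ->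
  (forall t : R, 0 <= t <= u -> is_derive t 1 f (df t)) ->
  exists2 s : R, 0 < s < u & f u - f 0 = df s * u.
Proof.
move=> u_gt0 fdf.
have [||s] := @MVT R f df 0 u u_gt0.
- by move=> t; rewrite in_itv /= => /andP[t0 tu]; apply: fdf; rewrite !ltW.
- apply: derivable_within_continuous => t; rewrite in_itv /= => /fdf dft.
  exact: ex_derive.
- by rewrite in_itv /= subr0 => su eqf; exists s.
Qed.

(** [phi t] is [g 0 t] minus the corrected trapezoidal rule on [0, t], less [C * t ^+ 4]. In its
    second derivative [g 2] cancels, leaving a multiple of [t] whose zeros fix the slope of [g 3]
    from 0. *)
Lemma unit_trapezoid_remainder (R : realType) (g : nat -> R -> R) :
  (forall (k : nat) (t : R), (k < 4)%N -> 0 <= t <= 1 ->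
     is_derive t 1 (g k) (g k.+1 t)) ->
  exists2 xi : R, 0 < xi < 1 &
    g 0 1 - g 0 0 = (g 1 0 + g 1 1) / 2 - g 3 0 / 12 - g 4 xi / 24.
Proof.
move=> dg.
(* [C] is chosen so that [phi] vanishes at 1 as well as at 0. *)
have [C CE] : exists C : R,
    C = g 0%N 1 - g 0%N 0 - (g 1%N 0 + g 1%N 1) / 2 + g 3%N 0 / 12.
  by eexists.
pose phi : R -> R := g 0%N - 2^-1 *: (id * (cst (g 1%N 0) + g 1%N))
  + (g 3%N 0 / 12) *: id ^+ 3 - C *: id ^+ 4.
pose dphi : R -> R := 2^-1 *: (g 1%N - cst (g 1%N 0) - id * g 2%N)
  + (g 3%N 0 / 4) *: id ^+ 2 - (4 * C) *: id ^+ 3.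
pose ddphi (t : R) : R := - t / 2 * (g 3%N t - g 3%N 0) - 12 * C * t ^+ 2.
have phiE (t : R) : phi t = g 0%N t - 2^-1 * (t * (g 1%N 0 + g 1%N t))
  + g 3%N 0 / 12 * t ^+ 3 - C * t ^+ 4 by [].
have dphiE (t : R) : dphi t = 2^-1 * (g 1%N t - g 1%N 0 - t * g 2%N t)
  + g 3%N 0 / 4 * t ^+ 2 - 4 * C * t ^+ 3 by [].
have phi' (t : R) : 0 <= t <= 1 -> is_derive t 1 phi (dphi t).
  move=> t01; have g0 := dg 0%N t isT t01; have g1 := dg 1%N t isT t01.
  have dt := is_derive_id t (1 : R).
  have dgt := is_deriveM dt (is_deriveD (is_derive_cst (g 1%N 0) t 1) g1).
  have dp := is_deriveB (is_deriveD (is_deriveB g0 (is_deriveZ 2^-1 dgt))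
    (is_deriveZ (g 3%N 0 / 12) (is_deriveX 3 dt)))
    (is_deriveZ C (is_deriveX 4 dt)).
  apply: (is_derive_eq dp).
  by rewrite dphiE /GRing.scale /= ?fctE; field.
have dphi' (t : R) : 0 <= t <= 1 -> is_derive t 1 dphi (ddphi t).
  move=> t01; have g1 := dg 1%N t isT t01; have g2 := dg 2%N t isT t01.
  have dt := is_derive_id t (1 : R).
  have dgt := is_deriveB (is_deriveB g1 (is_derive_cst (g 1%N 0) t 1))
    (is_deriveM dt g2).
  have dp := is_deriveB (is_deriveD (is_deriveZ 2^-1 dgt)
    (is_deriveZ (g 3%N 0 / 4) (is_deriveX 2 dt)))
    (is_deriveZ (4 * C) (is_deriveX 3 dt)).
  apply: (is_derive_eq dp).
  by rewrite /ddphi /GRing.scale /= ?fctE; field.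
clearbody phi dphi.
(* By the choice of [C], [phi] equals [g 0 0] at both 0 and 1, so [dphi] vanishes at some [s]. It
   also vanishes at 0, which gives a zero [u] of [ddphi]. *)
have [s /andP[s0 s1]] := @mvt_from0 R phi dphi 1 ltr01 phi'.
rewrite !phiE => eqs.
have {}eqs : dphi s = 0 by lra.
have [t|u /andP[u0 us]] := @mvt_from0 R dphi ddphi s s0.
  by move=> /andP[t0 ts]; apply: dphi'; rewrite t0 (le_trans ts)// ltW.
have dphi0 : dphi 0 = 0 by rewrite dphiE; ring.
rewrite eqs dphi0 subrr => /esym/eqP.
rewrite mulf_eq0 (gt_eqF s0) orbF /ddphi => /eqP equ.
have [t|xi /andP[xi0 xiu] eqxi] := @mvt_from0 R (g 3%N) (g 4%N) u u0.
  move=> /andP[t0 tu]; apply: dg => //.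
  by rewrite t0 (le_trans tu)// ltW// (lt_trans us).
exists xi; first by rewrite xi0 (lt_trans xiu)// (lt_trans us).
(* With [g 3 u - g 3 0 = g 4 xi * u], both terms of [ddphi u] are multiples of [u ^+ 2], which
   cancels. *)
have : C = - g 4%N xi / 24.
  apply: (mulIf (lt0r_neq0 (exprn_gt0 2 u0))).
  by move: equ; rewrite eqxi => equ; lra.
by rewrite CE; lra.
Qed.

(** Pull back to [0, 1] along the affine map [l]; each derivative brings out a factor [b - a]. No
    order between [a] and [b] is assumed, so the rule can also be run backwards. *)
Lemma trapezoid_remainder (R : realType) (f : R -> R) (a b : R) :
  0 < a -> 0 < b -> n_derivable_pos 4 f ->
  exists2 xi : R, 0 < xi < 1 &
    f b - f a = (b - a) * ((derive1 f a + derive1 f b) / 2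
                           - (b - a) ^+ 2 / 12 * derive1n 3 f a)
                - (b - a) ^+ 4 / 24 * derive1n 4 f ((1 - xi) * a + xi * b).
Proof.
move=> a0 b0 df.
pose l : R -> R := cst a + (b - a) *: id.
have lE (t : R) : l t = a + (b - a) * t by [].
pose g k : R -> R := (b - a) ^+ k *: (derive1n k f \o l).
have gE k (t : R) : g k t = (b - a) ^+ k * derive1n k f (l t) by [].
have [k t k4 t01|xi xi01] := @unit_trapezoid_remainder R g.
  have lt0 : 0 < l t.
    (* For [t > 0] the term [t * b] is positive and [(1 - t) * a] is nonnegative. *)
    rewrite lE; have [->|t_neq0] := eqVneq t 0; first by lra.
    by case/andP: t01 => t0 t1; nra.
  have dfk : is_derive (l t) 1 (derive1n k f) (derive1n k.+1 f (l t)).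
    rewrite derive1nS derive1E; apply: DeriveDef => //; exact: df.
  have dl : is_derive t 1 l (b - a).
    have dl := is_deriveD (is_derive_cst a t (1 : R))
      (is_deriveZ (b - a) (is_derive_id t (1 : R))).
    by apply: (is_derive_eq dl); rewrite /GRing.scale /=; ring.
  have dc := is_deriveZ ((b - a) ^+ k) (is_derive1_comp dfk dl).
  apply: (is_derive_eq dc).
  by rewrite gE /GRing.scale /= exprS; ring.
rewrite !gE !lE => eqg; exists xi => //.
have -> : (1 - xi) * a + xi * b = a + (b - a) * xi by ring.
move: eqg; rewrite derive1n0 !derive1n1 expr0 !mul1r !mulr1 !mulr0 !addr0 subrKC => ->.
move: (derive1n 4 f _) (derive1n 3 f a) (derive1 f a) (derive1 f b).
by move=> D4 D3 Da Db; field.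
Qed.

(** The splitting of [V] holds near [r], and differentiation is local. *)
Lemma derive1_add_pos (R : realType) (V Vp Vm : R -> R) (r : R) : 0 < r ->
  (forall x : R, 0 < x -> V x = Vp x + Vm x) ->
  derivable Vp r 1 -> derivable Vm r 1 ->
  derive1 V r = derive1 Vp r + derive1 Vm r.
Proof.
move=> r0 VE dp dm; rewrite !derive1E -deriveD//.
apply: near_eq_derive; near=> x; apply: VE.
by near: x; exact: lt_nbhsr.
Unshelve. all: by end_near. Qed.

Lemma sqr_enorm (R : realType) (q : 'rV[R]_3) :
  enorm q ^+ 2 = \sum_(i < 3) q 0 i ^+ 2.
Proof. by rewrite sqr_sqrtr// sumr_ge0// => i _; exact: sqr_ge0. Qed.

Lemma enorm_gt0 (R : realType) (q : 'rV[R]_3) : q != 0 -> 0 < enorm q.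
Proof.
move=> q_neq0; rewrite lt_neqAle sqrtr_ge0 andbT eq_sym.
apply: contra_neq q_neq0 => q0.
have : \sum_(i < 3) q 0 i ^+ 2 = 0 by rewrite -sqr_enorm q0 expr0n.
move=> /psumr_eq0P => /(_ (fun i _ => sqr_ge0 _)) q0i.
by apply/rowP => i; rewrite mxE; apply/eqP; rewrite -sqrf_eq0 q0i.
Qed.

Lemma angular_momentum_conserved (R : realType) (c k : R)
    (q0 q1 p0 p1 : 'rV[R]_3) :
  q1 - q0 = c *: interp (1 / 2) p0 p1 ->
  p1 - p0 = k *: interp (1 / 2) q0 q1 ->
  angular_momentum q1 p1 = angular_momentum q0 p0.
Proof.
move=> /rowP hq /rowP hp; apply/rowP => i; rewrite !mxE.
move: (hq (i + 1)) (hq (i + 2)) (hp (i + 1)) (hp (i + 2)); rewrite !mxE.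
move: (q0 0 (i + 1)) (q0 0 (i + 2)) (q1 0 (i + 1)) (q1 0 (i + 2)).
move: (p0 0 (i + 1)) (p0 0 (i + 2)) (p1 0 (i + 1)) (p1 0 (i + 2)).
move=> y0 z0 y1 z1 a0 b0 a1 b1 ha hb hy hz.
apply/eqP; rewrite -subr_eq0; apply/eqP.
(* Discrete product rule: the increment of q x p is dq x p_mid + q_mid x dp, and both are cross
   products of parallel vectors. *)
transitivity (2^-1 * ((a1 - a0) * (z0 + z1) - (b1 - b0) * (y0 + y1)
  + (a0 + a1) * (z1 - z0) - (b0 + b1) * (y1 - y0))); first by field.
by rewrite ha hb hy hz; field.
Qed.

(** Each coordinate of p1^2 - p0^2 is the same multiple of that of q1^2 - q0^2. After summation,
    [enorm q1 ^+ 2 - enorm q0 ^+ 2] contains the factor [enorm q0 + enorm q1], which cancels the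
    denominator [interp_norm (1 / 2) q0 q1] up to a constant. *)
Lemma kinetic_energy_increment (R : realType) (m dt F : R)
    (q0 q1 p0 p1 : 'rV[R]_3) :
  m != 0 -> dt != 0 -> 0 < enorm q0 -> 0 < enorm q1 ->
  q1 - q0 = (dt / m) *: interp (1 / 2) p0 p1 ->
  p1 - p0 = - ((dt * F) *: ((interp_norm (1 / 2) q0 q1)^-1
                            *: interp (1 / 2) q0 q1)) ->
  (2 * m)^-1 * enorm p1 ^+ 2 - (2 * m)^-1 * enorm p0 ^+ 2 =
    - (enorm q1 - enorm q0) * F.
Proof.
move=> m0 dt0 a0 b0 /rowP hq /rowP hp.
have s0 : enorm q0 + enorm q1 != 0 by rewrite gt_eqF// addr_gt0.
suff : enorm p1 ^+ 2 - enorm p0 ^+ 2 =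
   - (2 * m * F / (enorm q0 + enorm q1)) * (enorm q1 ^+ 2 - enorm q0 ^+ 2).
  by rewrite -mulrBr => ->; field; rewrite s0.
rewrite !sqr_enorm -!sumrB mulr_sumr; apply: eq_bigr => i _.
have := (hq i, hp i); rewrite !mxE /interp_norm.
move: (q0 0 i) (q1 0 i) (p0 0 i) (p1 0 i) => x0 x1 y0 y1 [hx hy].
have -> : y1 ^+ 2 - y0 ^+ 2 = (y0 + y1) * (y1 - y0) by ring.
have -> : y0 + y1 = 2 * m / dt * (x1 - x0).
  by rewrite hx; field; rewrite ?m0 ?dt0.
by rewrite hy; field; rewrite ?s0 ?dt0.
Qed.

Theorem proposition5 (R : realType) (V Vp Vm : R -> R)
  (hV : forall r : R, 0 < r -> V r = Vp r + Vm r)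
  (hVp : n_derivable_pos 4 Vp) (hVm : n_derivable_pos 4 Vm)
  (hVp4 : forall r : R, 0 < r -> 0 <= derive1n 4 Vp r)
  (hVm4 : forall r : R, 0 < r -> derive1n 4 Vm r <= 0)
  (m dt : R) (hm : 0 < m) (hdt : 0 < dt)
  (q0 q1 p0 p1 : 'rV[R]_3) (hq0 : q0 != 0) (hq1 : q1 != 0)
  (hq : q1 - q0 = (dt / m) *: interp (1 / 2) p0 p1)
  (hp : p1 - p0 =
        - ((dt * ((derive1 V (enorm q0) + derive1 V (enorm q1)) / 2
                  - (enorm q1 - enorm q0) ^+ 2 / 12
                    * (derive1n 3 Vp (enorm q0) + derive1n 3 Vm (enorm q1))))
           *: ((interp_norm (1 / 2) q0 q1)^-1 *: interp (1 / 2) q0 q1))) :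
  angular_momentum q1 p1 = angular_momentum q0 p0 /\
  exists xi1 xi2 : R,
    [/\ 0 < xi1 < 1, 0 < xi2 < 1,
        hamiltonian m V q1 p1 - hamiltonian m V q0 p0 =
          - ((enorm q1 - enorm q0) ^+ 4 / 24
             * (derive1n 4 Vp (interp_norm xi1 q0 q1)
                - derive1n 4 Vm (interp_norm xi2 q0 q1)))
      & - ((enorm q1 - enorm q0) ^+ 4 / 24
           * (derive1n 4 Vp (interp_norm xi1 q0 q1)
              - derive1n 4 Vm (interp_norm xi2 q0 q1))) <= 0].
Proof.
have a0 := enorm_gt0 hq0; have b0 := enorm_gt0 hq1; split.
  apply: (@angular_momentum_conserved _ (dt / m) _ q0 q1 p0 p1 hq).
  by rewrite hp scalerA -scaleNr.
have [xi1 /andP[xi1_gt0 xi1_lt1] EVp] := trapezoid_remainder a0 b0 hVp.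
(* Running backwards samples the third derivative of [Vm] at [q1], as the integrator does, and flips
   the sign of its remainder. The parameter becomes [1 - xi2] when read from [q0] to [q1]. *)
have [xi2 /andP[xi2_gt0 xi2_lt1] EVm] := trapezoid_remainder b0 a0 hVm.
have xi1_norm_gt0 : 0 < interp_norm xi1 q0 q1.
  by rewrite /interp_norm addr_gt0 ?mulr_gt0 ?subr_gt0.
have xi2_norm_gt0 : 0 < interp_norm (1 - xi2) q0 q1.
  by rewrite /interp_norm addr_gt0 ?mulr_gt0 ?subr_gt0 ?gtrBl.
exists xi1, (1 - xi2); split.
- by rewrite xi1_gt0.
- by rewrite subr_gt0 xi2_lt1 gtrBl.
- have dV r : 0 < r -> derive1 V r = derive1 Vp r + derive1 Vm r.
    move=> r0; apply: derive1_add_pos => //; first exact: (hVp 0).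
    exact: (hVm 0).
  have eqm : (1 - (1 - xi2)) * enorm q0 + (1 - xi2) * enorm q1 =
      (1 - xi2) * enorm q1 + xi2 * enorm q0 by ring.
  have := kinetic_energy_increment (lt0r_neq0 hm) (lt0r_neq0 hdt) a0 b0 hq hp.
  move: EVp EVm; rewrite /hamiltonian !dV// !hV// /interp_norm eqm.
  move: (derive1n 4 Vp _) (derive1n 4 Vm _) (derive1n 3 Vp _) (derive1n 3 Vm _).
  move: (derive1 Vp _) (derive1 Vp _) (derive1 Vm _) (derive1 Vm _).
  move: (Vp _) (Vp _) (Vm _) (Vm _) (_ * enorm p0 ^+ 2) (_ * enorm p1 ^+ 2).
  move: (enorm q0) (enorm q1) => a b P0 P1 M1 M0 K0 K1 dP dP' dM dM'.
  move=> P4 M4 P3 M3 EP EM EK.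
  (* The kinetic increment cancels the quadrature terms of both potentials, leaving only the
     fourth-order remainders. *)
  transitivity ((K1 - K0) + (P1 - P0) - (M0 - M1)); first by ring.
  by rewrite EK EP EM; field.
- rewrite oppr_le0 mulr_ge0//; last first.
    by rewrite subr_ge0 (le_trans (hVm4 _ _))// hVp4.
  by rewrite divr_ge0// exprn_even_ge0.
Qed.
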